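(* Let $R$ be a commutative unital ring, $\Gamma$ a discrete group, and let $(\Sigma,i,q)$ with gradings $c_\Sigma:\Sigma\to\Gamma$, $c_G:G\to\Gamma$ be a $\Gamma$-graded discrete $R$-twist over an ample Hausdorff groupoid $G$. Then $A_R(G;\Sigma)$ is a $\Gamma$-graded $R$-algebra with homogeneous components given by $$A_R(G;\Sigma)_\gamma:=\{f\in A_R(G;\Sigma):\mathrm{supp}_G(f)\subseteq G_\gamma\},\qquad \gamma\in\Gamma,$$ where $G_\gamma=c_G^{-1}(\gamma)$.
   Context: **Twists.** An open bisection of a topological groupoid is an open set $B$ with $r(B),s(B)$ open and $r|_B,s|_B$ homeomorphisms onto their images; a topological groupoid is ample if it has a basis of compact open bisections. A discrete $R$-twist over an ample groupoid $G$ is a sequence $G^{(0)}\times R^\times\xrightarrow{i}\Sigma\xrightarrow{q}G$, with $R^\times$ the discrete unit group, $G^{(0)}\times R^\times$ the trivial group bundle, $\Sigma$ a topological groupoid with $\Sigma^{(0)}=i(G^{(0)}\times\{1\})$, and $i,q$ continuous groupoid homomorphisms restricting to homeomorphisms of unit spaces, such that: (DT1) $i(\{x\}\times R^\times)=q^{-1}(x)$ for $x\in G^{(0)}$, $i$ injective, $q$ surjective; (DT2) each $\alpha\in G$ has an open bisection $B_\alpha\ni\alpha$ and a continuous $P_\alpha:B_\alpha\to\Sigma$ with $q\circ P_\alpha=\mathrm{id}$ and $(\beta,t)\mapsto i(r(\beta),t)P_\alpha(\beta)$ a homeomorphism $B_\alpha\times R^\times\to q^{-1}(B_\alpha)$;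 (DT3) $i(r(\sigma),t)\sigma=\sigma i(s(\sigma),t)$. Write $t\cdot\sigma=i(r(\sigma),t)\sigma$. It is $\Gamma$-graded if equipped with continuous groupoid homomorphisms $c_\Sigma:\Sigma\to\Gamma$, $c_G:G\to\Gamma$ with $c_\Sigma=c_G\circ q$. **Twisted Steinberg algebra.** $A_R(G;\Sigma)$ is the set of locally constant $f:\Sigma\to R$ with $f(t\cdot\sigma)=t^{-1}f(\sigma)$ for $t\in R^\times$, $\sigma\in\Sigma$, and $\mathrm{supp}_G(f):=q(\mathrm{supp}(f))$ compact, where $\mathrm{supp}(f)=\{\sigma:f(\sigma)\ne0\}$. Linear operations are pointwise and $(f*g)(\sigma)=\sum_{\alpha\in\mathrm{supp}_G(f),\,r(\alpha)=r(\sigma)}f(S(\alpha))g(S(\alpha)^{-1}\sigma)$ for any (not necessarily continuous) section $S:\mathrm{supp}_G(f)\to\mathrm{supp}(f)$ of $q$ (independent of $S$); this makes it an associative $R$-algebra. **Graded algebra.** An $R$-algebra $A$ is $\Gamma$-graded with components $A_\gamma$ if the $A_\gamma$ are $R$-submodules, $A=\bigoplus_{\gamma\in\Gamma}A_\gamma$, and $A_\gamma A_\lambda\subseteq A_{\gamma\lambda}$ for all $\gamma,\lambda\in\Gamma$. *)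

(* Defs.v *)
From HB Require Import structures.
From mathcomp Require Import all_boot all_order all_algebra.
From mathcomp Require Import all_classical topology.

Set Implicit Arguments.
Unset Strict Implicit.
Unset Printing Implicit Defensive.

Import GRing.Theory.

Local Open Scope classical_set_scope.
Local Open Scope ring_scope.

(* Groupoids are given by their arrows, a unit being an arrow equal to its own *)
(* source. The product is a total function: gmul a b is meaningful only when   *)
(* gsrc a = grng b, and nothing is assumed about it otherwise.                 *)
HB.mixin Record isGroupoid G := {
  gsrc : G -> G;
  grng : G -> G;
  gmul : G -> G -> G;
  ginv : G -> G;
  gsrc_src : forall a, gsrc (gsrc a) = gsrc a;
  grng_src : forall a, grng (gsrc a) = gsrc a;
  gsrc_rng : forall a, gsrc (grng a) = grng a;
  grng_rng : forall a, grng (grng a) = grng a;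
  gsrcM : forall a b, gsrc a = grng b -> gsrc (gmul a b) = gsrc b;
  grngM : forall a b, gsrc a = grng b -> grng (gmul a b) = grng a;
  gmulA : forall a b c, gsrc a = grng b -> gsrc b = grng c ->
    gmul a (gmul b c) = gmul (gmul a b) c;
  gmul_rng : forall a, gmul (grng a) a = a;
  gmul_src : forall a, gmul a (gsrc a) = a;
  gsrcV : forall a, gsrc (ginv a) = grng a;
  grngV : forall a, grng (ginv a) = gsrc a;
  gmulV : forall a, gmul a (ginv a) = grng a;
  gmulVg : forall a, gmul (ginv a) a = gsrc a
}.

#[short(type="groupoidType")]
HB.structure Definition Groupoid := {G of isGroupoid G}.

Definition composable (G : groupoidType) : set (G * G) :=
  [set ab | gsrc ab.1 = grng ab.2].
Arguments composable : clear implicits.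

Definition gunits (G : groupoidType) : set G := [set x | gsrc x = x].
Arguments gunits : clear implicits.

Lemma gunits_rng (G : groupoidType) (a : G) : gunits G (grng a).
Proof. exact: gsrc_rng. Qed.

Lemma gunits_src (G : groupoidType) (a : G) : gunits G (gsrc a).
Proof. exact: gsrc_src. Qed.

Definition grng_unit (G : groupoidType) (a : G) : gunits G :=
  SigSub (mem_set (gunits_rng a)).

Definition gsrc_unit (G : groupoidType) (a : G) : gunits G :=
  SigSub (mem_set (gunits_src a)).

Section GroupoidTheory.
Variable G : groupoidType.
Implicit Types a b c : G.

Lemma gmulVK a b : grng a = grng b -> gmul a (gmul (ginv a) b) = b.
Proof.
by move=> ab; rewrite gmulA ?grngV ?gsrcV // gmulV ab gmul_rng.
Qed.

Lemma gmulKV a b : gsrc a = grng b -> gmul (ginv a) (gmul a b) = b.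
Proof.
by move=> ab; rewrite gmulA ?gsrcV // gmulVg ab gmul_rng.
Qed.

Lemma ginv_eq a b : gsrc a = grng b -> gmul a b = grng a -> b = ginv a.
Proof.
move=> ab e; rewrite -[LHS](gmulKV ab) e.
by rewrite -gsrcV gmul_src.
Qed.

Lemma idem_gunit a : gsrc a = grng a -> gmul a a = a -> a = gsrc a.
Proof. by move=> sr aa; rewrite -{1}(gmulKV sr) aa gmulVg. Qed.

End GroupoidTheory.

(* Continuity of gsrc and grng follows, e.g. gsrc a = a^-1 a. *)
HB.mixin Record Groupoid_isTopological G of Groupoid G & Topological G := {
  ginv_continuous : continuous (@ginv G);
  gmul_continuous :
    {within composable G, continuous (fun ab : G * G => gmul ab.1 ab.2)}
}.

#[short(type="topologicalGroupoidType")]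
HB.structure Definition TopologicalGroupoid :=
  {G of Groupoid G & Topological G & Groupoid_isTopological G}.

Definition groupoid_hom (G H : groupoidType) (f : G -> H) : Prop :=
  forall a b, gsrc a = grng b ->
    gsrc (f a) = grng (f b) /\ f (gmul a b) = gmul (f a) (f b).

Section GroupoidHom.
Variables (G H : groupoidType) (f : G -> H).
Hypothesis homf : groupoid_hom f.

Lemma ghom_src a : f (gsrc a) = gsrc (f a).
Proof.
have [sr _] : gsrc (f a) = grng (f (gsrc a)) /\ _ := homf (esym (grng_src a)).
have ss : gsrc (gsrc a) = grng (gsrc a) by rewrite gsrc_src grng_src.
have [sr' fM] := homf ss.
have sa : gmul (gsrc a) (gsrc a) = gsrc a by rewrite -{2}[gsrc a]gsrc_src gmul_src.
by rewrite sa in fM; rewrite [LHS](idem_gunit sr' (esym fM)) sr' sr.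
Qed.

Lemma ghom_rng a : f (grng a) = grng (f a).
Proof.
have [<- _] := homf (gsrc_rng a).
by rewrite -ghom_src gsrc_rng.
Qed.

Lemma ghomV a : f (ginv a) = ginv (f a).
Proof.
have aV : gsrc a = grng (ginv a) by rewrite grngV.
by have [sr fM] := homf aV; apply: ginv_eq; rewrite // -fM gmulV ghom_rng.
Qed.

End GroupoidHom.

Definition homeomorphism_on (X Y : topologicalType) (A : set X) (B : set Y)
    (f : X -> Y) : Prop :=
  [/\ set_bij A B f, {within A, continuous f} &
      forall U, open U -> exists2 V, open V & f @` (U `&` A) = V `&` B].

Definition open_bisection (G : topologicalGroupoidType) (B : set G) : Prop :=
  [/\ open B, open (@grng G @` B), open (@gsrc G @` B),
      homeomorphism_on B (@grng G @` B) (@grng G) &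
      homeomorphism_on B (@gsrc G @` B) (@gsrc G)].

Definition ample (G : topologicalGroupoidType) : Prop :=
  basis [set B : set G | compact B /\ open_bisection B].

(* The group of units of R: pairs (t, t^-1). *)
Definition ring_units (R : comPzRingType) : Type :=
  {p : R * R | p.1 * p.2 == 1}.

Section RingUnits.
Variable R : comPzRingType.

HB.instance Definition _ :=
  Choice.copy (ring_units R) {p : R * R | p.1 * p.2 == 1}.

Definition uval (t : ring_units R) : R := (val t).1.

Lemma uval_inj : injective uval.
Proof.
move=> t u tu; apply/val_inj; move: tu (eqP (valP t)) (eqP (valP u)).
rewrite /uval; case: (val t) (val u) => [a b] [c d] /= -> cb cd.
by congr pair; rewrite -[b]mulr1 -cd mulrA [b * c]mulrC cb mul1r.
Qed.

Lemma uone_subproof : 1 * 1 == 1 :> R.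
Proof. by rewrite mulr1. Qed.

Lemma uinv_subproof (t : ring_units R) : (val t).2 * (val t).1 == 1.
Proof. by rewrite mulrC; exact: (valP t). Qed.

Lemma umul_subproof (t u : ring_units R) :
  (val t).1 * (val u).1 * ((val t).2 * (val u).2) == 1.
Proof. by rewrite mulrACA (eqP (valP t)) (eqP (valP u)) mulr1. Qed.

Definition uone : ring_units R := Sub (1, 1) uone_subproof.
Definition uinv (t : ring_units R) : ring_units R :=
  Sub ((val t).2, (val t).1) (uinv_subproof t).
Definition umul (t u : ring_units R) : ring_units R :=
  Sub ((val t).1 * (val u).1, (val t).2 * (val u).2) (umul_subproof t u).

Lemma umulA : associative umul.
Proof. by move=> t u v; apply: uval_inj; rewrite /uval /= mulrA. Qed.

Lemma umul1 : left_id uone umul.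
Proof. by move=> t; apply: uval_inj; rewrite /uval /= mul1r. Qed.

Lemma umulr1 : right_id uone umul.
Proof. by move=> t; apply: uval_inj; rewrite /uval /= mulr1. Qed.

Lemma umulV : left_inverse uone uinv umul.
Proof.
by move=> t; apply: uval_inj; rewrite /uval /= mulrC (eqP (valP t)).
Qed.

Lemma umulrV : right_inverse uone uinv umul.
Proof. by move=> t; apply: uval_inj; rewrite /uval /= (eqP (valP t)). Qed.

HB.instance Definition _ := isGroup.Build (ring_units R)
  umulA umul1 umulr1 umulV umulrV.

HB.instance Definition _ :=
  Topological.copy (ring_units R) (discrete_topology (ring_units R)).
HB.instance Definition _ :=
  DiscreteTopology.copy (ring_units R) (discrete_topology (ring_units R)).

End RingUnits.

(* The trivial group bundle, with the product of the subspace topology on the *)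
(* unit space and the discrete topology on the units of R.                     *)
Definition unit_bundle (G : topologicalGroupoidType) (R : comPzRingType) :
  Type := (gunits G * ring_units R)%type.

Section UnitBundle.
Variables (G : topologicalGroupoidType) (R : comPzRingType).
Local Notation B := (unit_bundle G R).

HB.instance Definition _ := Topological.copy B (gunits G * ring_units R)%type.

Definition bundle_unit (a : B) : B := (a.1, 1%g).
Definition bundle_mul (a b : B) : B := (a.1, (a.2 * b.2)%g).
Definition bundle_inv (a : B) : B := (a.1, (a.2^-1)%g).

Fact bundle_src_src a : bundle_unit (bundle_unit a) = bundle_unit a.
Proof. by []. Qed.

Fact bundle_srcM a b : bundle_unit a = bundle_unit b ->
  bundle_unit (bundle_mul a b) = bundle_unit b.
Proof. by []. Qed.

Fact bundle_rngM a b : bundle_unit a = bundle_unit b ->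
  bundle_unit (bundle_mul a b) = bundle_unit a.
Proof. by []. Qed.

Fact bundle_mulA a b c : bundle_unit a = bundle_unit b ->
  bundle_unit b = bundle_unit c ->
  bundle_mul a (bundle_mul b c) = bundle_mul (bundle_mul a b) c.
Proof. by rewrite /bundle_mul /= mulgA. Qed.

Fact bundle_mul_rng a : bundle_mul (bundle_unit a) a = a.
Proof. by case: a => x t; rewrite /bundle_mul /= mul1g. Qed.

Fact bundle_mul_src a : bundle_mul a (bundle_unit a) = a.
Proof. by case: a => x t; rewrite /bundle_mul /= mulg1. Qed.

Fact bundle_unitV a : bundle_unit (bundle_inv a) = bundle_unit a.
Proof. by []. Qed.

Fact bundle_mulV a : bundle_mul a (bundle_inv a) = bundle_unit a.
Proof. by rewrite /bundle_mul /= mulgV. Qed.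

Fact bundle_mulVg a : bundle_mul (bundle_inv a) a = bundle_unit a.
Proof. by rewrite /bundle_mul /= mulVg. Qed.

HB.instance Definition _ := isGroupoid.Build B
  bundle_src_src bundle_src_src bundle_src_src bundle_src_src
  bundle_srcM bundle_rngM bundle_mulA bundle_mul_rng bundle_mul_src
  bundle_unitV bundle_unitV bundle_mulV bundle_mulVg.

Fact nbhs_bundle (a : B) (P : set (gunits G)) : nbhs a.1 P ->
  nbhs a (P `*` [set a.2] : set B).
Proof.
by move=> aP; exists (P, [set a.2]) => //; split=> //; exact: discrete_set1.
Qed.

Fact bundle_inv_continuous : continuous bundle_inv.
Proof.
move=> a W [[P Q] /= [aP /nbhs_singleton aQ] PQW].
by apply: filterS (nbhs_bundle aP) => b /= [Pb ba]; apply: PQW; rewrite /= ba.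
Qed.

Fact bundle_mul_continuous :
  {within composable B, continuous (fun ab : B * B => bundle_mul ab.1 ab.2)}.
Proof.
apply: continuous_subspaceT => -[a b] W [[P Q] /= [aP /nbhs_singleton abQ] PQW].
exists (P `*` [set a.2], setT `*` [set b.2]) => /=.
  split; first exact: nbhs_bundle.
  by apply: nbhs_bundle; exact: filterT.
move=> [c d] /= [[Pc ca] [_ db]].
by apply: PQW; split; [exact: Pc | rewrite /= ca db].
Qed.

HB.instance Definition _ := Groupoid_isTopological.Build B
  bundle_inv_continuous bundle_mul_continuous.

End UnitBundle.

(* The unit spaces of G and Sigma are identified along q: for sigma in Sigma, *)
(* i (r sigma, t) is i (r (q sigma), t), and similarly for the source.         *)
Definition twist_act (R : comPzRingType) (G Sigma : topologicalGroupoidType)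
    (i : unit_bundle G R -> Sigma) (q : Sigma -> G)
    (t : ring_units R) (sigma : Sigma) : Sigma :=
  gmul (i (grng_unit (q sigma), t)) sigma.

Record discrete_twist (R : comPzRingType) (G Sigma : topologicalGroupoidType)
    (i : unit_bundle G R -> Sigma) (q : Sigma -> G) : Prop := DiscreteTwist {
  twist_i_continuous : continuous i;
  twist_i_hom : groupoid_hom i;
  twist_i_units :
    homeomorphism_on (gunits (unit_bundle G R)) (gunits Sigma) i;
  twist_q_continuous : continuous q;
  twist_q_hom : groupoid_hom q;
  twist_q_units : homeomorphism_on (gunits Sigma) (gunits G) q;
  twist_units : gunits Sigma = i @` [set a | a.2 = 1%g];
  twist_fibre : forall x : gunits G,
    i @` [set a | a.1 = x] = q @^-1` [set \val x];
  twist_i_inj : injective i;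
  twist_q_surj : forall alpha, exists sigma, q sigma = alpha;
  twist_local_triv : forall alpha : G, exists B : set G, exists P : G -> Sigma,
    [/\ open_bisection B, B alpha, {within B, continuous P},
        (forall beta, B beta -> q (P beta) = beta) &
        homeomorphism_on (B `*` [set: ring_units R]) (q @^-1` B)
          (fun bt : G * ring_units R =>
             gmul (i (grng_unit bt.1, bt.2)) (P bt.1))];
  twist_central : forall (sigma : Sigma) (t : ring_units R),
    gmul (i (grng_unit (q sigma), t)) sigma =
    gmul sigma (i (gsrc_unit (q sigma), t))
}.

(* Continuous homomorphism to the discrete group Gamma. *)
Definition group_cocycle (Gamma : groupType) (G : topologicalGroupoidType)
    (c : G -> Gamma) : Prop :=
  continuous (c : G -> discrete_topology Gamma) /\
  forall a b, gsrc a = grng b -> c (gmul a b) = (c a * c b)%g.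

Definition twist_grading (Gamma : groupType) (G Sigma : topologicalGroupoidType)
    (q : Sigma -> G) (cSigma : Sigma -> Gamma) (cG : G -> Gamma) : Prop :=
  [/\ group_cocycle cSigma, group_cocycle cG & cSigma = cG \o q].

Section TwistedSteinberg.
Variables (R : comPzRingType) (G Sigma : topologicalGroupoidType).
Variables (i : unit_bundle G R -> Sigma) (q : Sigma -> G).

Definition supp_quot (f : Sigma -> R^o) : set G :=
  q @` [set sigma | f sigma != 0].

Definition twisted_steinberg : set (Sigma -> R^o) :=
  [set f : Sigma -> R^o |
    [/\ (forall sigma, \forall tau \near sigma, f tau = f sigma),
        (forall (t : ring_units R) (sigma : Sigma),
           f (twist_act i q t sigma) = uval t^-1%g * f sigma) &
        compact (supp_quot f)]].

Definition supp_section (f : Sigma -> R^o) (S : G -> Sigma) : Prop :=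
  forall alpha, supp_quot f alpha ->
    f (S alpha) != 0 /\ q (S alpha) = alpha.

(* For f in twisted_steinberg the sum has finitely many nonzero terms. *)
Definition convolution_with (f : Sigma -> R^o) (S : G -> Sigma)
    (g : Sigma -> R^o) : Sigma -> R^o := fun sigma =>
  \sum_(alpha \in [set alpha | supp_quot f alpha /\ grng alpha = grng (q sigma)])
    f (S alpha) * g (gmul (ginv (S alpha)) sigma).

(* A chosen section; sigma is a default value outside supp_quot f. *)
Definition some_section (f : Sigma -> R^o) (sigma : Sigma) (alpha : G) : Sigma :=
  xget sigma [set tau | f tau != 0 /\ q tau = alpha].

Definition convolution (f g : Sigma -> R^o) : Sigma -> R^o := fun sigma =>
  convolution_with f (some_section f sigma) g sigma.

Lemma some_sectionP (f : Sigma -> R^o) (sigma : Sigma) :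
  supp_section f (some_section f sigma).
Proof.
move=> alpha [tau ftau qtau]; rewrite /some_section.
by case: xgetP => [rho -> [frho qrho]|/(_ tau)]; [|case].
Qed.

(* The product may be computed with any section of q over supp_quot f. *)
Lemma convolution_section (f g : Sigma -> R^o) (S : G -> Sigma) :
  discrete_twist i q -> twisted_steinberg f -> twisted_steinberg g ->
  supp_section f S -> convolution f g = convolution_with f S g.
Proof.
move=> tw [_ ft _] [_ gt _] fS; apply/funext => sigma.
rewrite /convolution /convolution_with; apply: eq_fsbigr => alpha.
rewrite inE /= => -[alphaf rsigma].
have [_] := some_sectionP sigma alphaf; have [_] := fS _ alphaf.
move: (S alpha) (some_section f sigma alpha) => tau rho qtau qrho.
have homq := twist_q_hom tw; have homi := twist_i_hom tw.
have injq (x y : Sigma) : gunits Sigma x -> gunits Sigma y -> q x = q y -> x = y.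
  have [[_ + _] _ _] := twist_q_units tw; move=> qinj xu yu; apply: qinj;
  by apply/mem_set.
have qi (x : gunits G) t : q (i (x, t)) = \val x.
  have : (q @^-1` [set \val x]) (i (x, t)).
    by rewrite -(twist_fibre tw); exists (x, t).
  by [].
have valu (x : gunits G) : gsrc (\val x) = \val x by exact: (set_valP x).
have srci x t y : \val x = grng (q y) -> gsrc (i (x, t)) = grng y.
  move=> xy; apply: injq; [exact: gunits_src|exact: gunits_rng|].
  by rewrite (ghom_src homq) (ghom_rng homq) qi valu.
have rngi x t y : \val x = gsrc (q y) -> grng (i (x, t)) = gsrc y.
  move=> xy; apply: injq; [exact: gunits_rng|exact: gunits_src|].
  by rewrite (ghom_rng homq) (ghom_src homq) qi xy grng_src.
have rts : grng tau = grng sigma.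
  apply: injq; [exact: gunits_rng|exact: gunits_rng|].
  by rewrite !(ghom_rng homq) qtau.
have rrt : grng rho = grng tau.
  apply: injq; [exact: gunits_rng|exact: gunits_rng|].
  by rewrite !(ghom_rng homq) qtau qrho.
have srt : gsrc rho = gsrc tau.
  apply: injq; [exact: gunits_src|exact: gunits_src|].
  by rewrite !(ghom_src homq) qtau qrho.
have [t rhoE] : exists t, rho = twist_act i q t tau.
  have rtV : gsrc rho = grng (ginv tau) by rewrite grngV.
  have : (q @^-1` [set \val (grng_unit (q tau))]) (gmul rho (ginv tau)).
    rewrite /preimage /=; have [_ ->] := homq _ _ rtV.
    by rewrite (ghomV homq) qrho qtau gmulV.
  rewrite -(twist_fibre tw) => -[[x t] /= -> e]; exists t; rewrite /twist_act e.
  by rewrite -gmulA ?gsrcV // gmulVg -srt gmul_src.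
pose w := gmul (ginv rho) sigma.
have rw : grng w = gsrc tau by rewrite grngM ?grngV // gsrcV rrt.
have rqw : grng (q w) = gsrc (q tau).
  by rewrite -(ghom_rng homq) rw (ghom_src homq).
have unitE : grng_unit (q w) = gsrc_unit (q tau) by exact: val_inj.
have -> : gmul (ginv tau) sigma = twist_act i q t w.
  have -> : sigma = gmul rho w by rewrite gmulVK // rrt.
  have stu : gsrc tau = grng (i (gsrc_unit (q tau), t)) by rewrite (rngi _ _ tau).
  have suw : gsrc (i (gsrc_unit (q tau), t)) = grng w by exact: srci.
  rewrite {1}rhoE /twist_act (twist_central tw) -gmulA //.
  by rewrite gmulKV ?unitE // grngM.
rewrite -/w rhoE ft gt; move: (f tau) (g w) (uval _) => x y z.
by rewrite mulrCA mulrA.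
Qed.

End TwistedSteinberg.

Section GradedAlgebra.
Variables (R : pzRingType) (V : lmodType R).

Definition submodule (M : set V) : Prop :=
  [/\ M 0, (forall u v, M u -> M v -> M (u + v)) &
      forall (c : R) u, M u -> M (c *: u)].

(* A is an associative, not necessarily unital, R-algebra for the operations *)
(* of V and the product mul.                                                  *)
Record assoc_algebra (A : set V) (mul : V -> V -> V) : Prop := AssocAlgebra {
  alg_submodule : submodule A;
  alg_mul : forall u v, A u -> A v -> A (mul u v);
  alg_mulA : forall u v w, A u -> A v -> A w ->
    mul u (mul v w) = mul (mul u v) w;
  alg_mulDl : forall u v w, A u -> A v -> A w ->
    mul (u + v) w = mul u w + mul v w;
  alg_mulDr : forall u v w, A u -> A v -> A w ->
    mul u (v + w) = mul u v + mul u w;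
  alg_scalel : forall (c : R) u v, A u -> A v -> mul (c *: u) v = c *: mul u v;
  alg_scaler : forall (c : R) u v, A u -> A v -> mul u (c *: v) = c *: mul u v
}.

Definition internal_direct_sum (I : choiceType) (A : set V) (M : I -> set V) :
    Prop :=
  (forall j, M j `<=` A) /\
  forall u, A u -> exists! w : I -> V,
    [/\ forall j, M j (w j), finite_set [set j | w j != 0] &
        u = \sum_(j \in [set: I]) w j].

Record graded_algebra (Gamma : groupType) (A : set V) (mul : V -> V -> V)
    (M : Gamma -> set V) : Prop := GradedAlgebra {
  graded_assoc : assoc_algebra A mul;
  graded_submodule : forall gamma, submodule (M gamma);
  graded_sum : internal_direct_sum A M;
  graded_mul : forall gamma lambda u v, M gamma u -> M lambda v ->
    M (gamma * lambda)%g (mul u v)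
}.

End GradedAlgebra.

Definition steinberg_component (R : comPzRingType)
    (G Sigma : topologicalGroupoidType) (i : unit_bundle G R -> Sigma)
    (q : Sigma -> G) (Gamma : groupType) (cG : G -> Gamma) (gamma : Gamma) :
    set (Sigma -> R^o) :=
  [set f | twisted_steinberg i q f /\
           supp_quot q f `<=` cG @^-1` [set gamma]].

(* Main.v *)
From HB Require Import structures.
Require Import Defs.
From mathcomp Require Import all_boot all_order all_algebra finmap.
From mathcomp Require Import all_classical topology.

Set Implicit Arguments.
Unset Strict Implicit.
Unset Printing Implicit Defensive.

Import GRing.Theory.
Local Open Scope classical_set_scope.
Local Open Scope ring_scope.

(** Two facts have to be established: the convolution makes A_R(G; Sigma) an
    associative algebra, and this algebra splits along the values of c_G.

    The convolution is a sum over the arrows of supp_G f with a prescribed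
    range, and local constancy or associativity are hard to read off this sum.
    They become easy when supp_G f lies in a bisection B: the sum then has at
    most one term, and the product is characterised by (f * g)(ab) = f(a) g(b)
    whenever q a lies in B (convolution_bisection), together with (f * g)(c) = 0
    when r(q c) is not in r(B) (convolution_out). Since G is ample, the twist is
    locally trivial and compact subsets of the Hausdorff space G are closed,
    every compact set is covered by finitely many clopen bisections over which q
    has a continuous section (compact_slices). Cutting a function along such
    clopen sets proves an induction principle (steinberg_ind): a property
    stable under sums holds on the whole of A_R(G; Sigma) once it holds for
    the functions supported in one of these bisections.

    Closure under convolution is obtained in this way. Equivariance is the
    identity t.(ab) = (t.a)b. Local constancy at c, when r(q c) is the range
    of some beta in supp_G f, holds because r is open on B: the factorisation
    of a point near c starts with P(beta') for some beta' near beta. When no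
    such beta exists, the compact set r(supp_G f) is closed and is missed by
    the ranges of all the points near c. Compactness of the support follows
    from the inclusion of supp_G(f * g) in the product supp_G f . supp_G g,
    which is compact because composability is a closed condition, and from the
    fact that supports are clopen. Associativity is proved by the induction
    principle applied to f and to g: if they live over bisections B and C,
    then f * g lives over the bisection BC, and both bracketings take the value
    f(a) g(b) h(c) at abc.

    For the grading, c_G is locally constant, so its fibres are clopen and
    the restriction of u to c_Sigma^-1(gamma) is again in A_R(G; Sigma). Only
    finitely many restrictions are nonzero because c_G takes finitely many
    values on the compact set supp_G u, their sum is u, and evaluating at each
    point shows that there is no other decomposition. Multiplicativity is
    again the inclusion of supp_G(f * g) in supp_G f . supp_G g. *)

(** * Finite covers and finite sums *)

(** Finite subcovers are available for pointed spaces; a point of K, when there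
    is one, serves as the base point. *)
Lemma compact_seq_cover (T : topologicalType) (K : set T) (Q : set (set T)) :
  compact K -> Q `<=` open -> (forall x, exists2 B, Q B & B x) ->
  exists s : seq (set T), [set` s] `<=` Q /\ K `<=` \bigcup_(B in [set` s]) B.
Proof.
move=> cK oQ covQ.
have [[k _]|/nonemptyPn K0] := pselect (K !=set0); last first.
  by exists [::]; split=> // x; rewrite K0.
pose pT : ptopologicalType :=
  HB.pack_for ptopologicalType T (isPointed.Build T k).
have : cover_compact (K : set pT) by rewrite -(@compact_cover pT).
move=> /(_ _ Q id oQ)[x _|D DQ KD]; first by have [B] := covQ x; exists B.
by exists (enum_fset D); split=> // B /DQ; rewrite inE.
Qed.

(** A finite sum of functions only one of which may be nonzero at x. The
    finiteness hypothesis concerns the functions themselves: a sum with infinite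
    support is 0 by convention, even if it is finite at every point. *)
Lemma fsum_eval (I : choiceType) (T : Type) (V : nmodType) (w : I -> T -> V)
    (x : T) (j : I) : finite_set [set k | w k != 0] ->
  (forall k, k != j -> w k x = 0) -> (\sum_(k \in [set: I]) w k) x = w j x.
Proof.
move=> finw wx; pose D := [set k | w k != 0] `|` [set j].
have finD : finite_set D by rewrite finite_setU; split=> //; exact: finite_set1.
rewrite -(fsbig_widen D)//; last first.
  by move=> k [_ nDk]; apply: contrapT => /eqP wk; apply: nDk; left.
rewrite fsbig_finite// fct_sumE (bigD1_seq j)//=; last first.
  by rewrite in_fset_set// inE; right.
by rewrite big1 ?addr0// => k /wx.
Qed.

Lemma clopen_near (T : topologicalType) (B : set T) x : clopen B ->
  \forall y \near x, (y \in B) = (x \in B).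
Proof.
move=> [oB cB]; have [Bx|nBx] := pselect (B x).
  apply: filterS (open_nbhs_nbhs (conj oB Bx)) => y By.
  by rewrite !mem_set.
have oC : open (~` B) by rewrite openC.
apply: filterS (open_nbhs_nbhs (conj oC nBx)) => y By.
by rewrite !memNset.
Qed.

(** * Topological groupoids *)

Section TopologicalGroupoids.
Variable G : topologicalGroupoidType.

Lemma near_gmul (a b : G) (W : set G) : gsrc a = grng b ->
  nbhs (gmul a b) W ->
  \forall cd \near (a, b), gsrc cd.1 = grng cd.2 -> W (gmul cd.1 cd.2).
Proof.
move=> ab Wab; have /subspace_continuousP := @gmul_continuous G.
by move=> /(_ (a, b) ab W Wab).
Qed.

(** Continuity comes from s(a) = a^-1 a. *)
Lemma gsrc_continuous : continuous (@gsrc G).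
Proof.
move=> a W Wa; have aa : gsrc (ginv a) = grng a by rewrite gsrcV.
rewrite -(gmulVg a) in Wa.
have [[U V] /= [aU aV] UV] := near_gmul aa Wa.
have aU' : \forall c \near a, U (ginv c) := @ginv_continuous G a _ aU.
apply: filterS2 aU' aV => c Uc Vc.
by rewrite /preimage /= -gmulVg; apply: (UV (ginv c, c)); rewrite ?gsrcV.
Qed.

Lemma grng_continuous : continuous (@grng G).
Proof.
move=> a W; rewrite -gsrcV => Wa.
have cW : \forall c \near ginv a, W (gsrc c) := gsrc_continuous Wa.
have : \forall c \near a, W (gsrc (ginv c)) := @ginv_continuous G a _ cW.
by apply: filterS => c; rewrite /preimage /= gsrcV.
Qed.

Definition range_inj (B : set G) := forall alpha beta, B alpha -> B beta ->
  grng alpha = grng beta -> alpha = beta.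

Definition set_gmul (A B : set G) : set G :=
  [set gmul ab.1 ab.2 | ab in (A `*` B) `&` composable G].

Lemma range_inj_gmul (B C : set G) :
  range_inj B -> range_inj C -> range_inj (set_gmul B C).
Proof.
move=> injB injC _ _ [[a c] [[/= Ba Cc] ac] <-] [[a' c'] [[/= Ba' Cc'] ac'] <-].
rewrite /composable /= in ac ac'; rewrite /= !grngM// => aa'.
have aE : a = a' by apply: injB.
by subst a'; congr gmul; apply: injC => //; rewrite -ac.
Qed.

Hypothesis hausG : hausdorff_space G.

(** Composability is the equality of two continuous maps into G. *)
Lemma composable_closed : closed (composable G).
Proof.
move=> -[a b] clab; rewrite /composable /=; apply: hausG => U V Ua Vb.
have Ua' : \forall c \near a, U (gsrc c) := gsrc_continuous Ua.
have Vb' : \forall c \near b, V (grng c) := grng_continuous Vb.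
have [[c d]] := clab _ (ex_intro2 _ _ (_, _) (conj Ua' Vb') (fun _ h => h)).
by move=> [/= cd [Uc Vd]]; exists (gsrc c); split=> //; rewrite cd.
Qed.

Lemma compact_set_gmul (A B : set G) :
  compact A -> compact B -> compact (set_gmul A B).
Proof.
move=> cA cB; apply: continuous_compact.
  apply: continuous_subspaceW; last exact: gmul_continuous.
  by move=> ab [].
by apply: compact_closedI; [exact: compact_setX|exact: composable_closed].
Qed.

End TopologicalGroupoids.

(** * Arithmetic in a twist *)

Section Twists.
Variables (R : comPzRingType) (G Sigma : topologicalGroupoidType).
Variables (i : unit_bundle G R -> Sigma) (q : Sigma -> G).
Hypothesis tw : discrete_twist i q.
Implicit Types (a b : Sigma) (t : ring_units R) (f g h : Sigma -> R^o).

Let homq : groupoid_hom q := twist_q_hom tw.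

Lemma q_src a : q (gsrc a) = gsrc (q a). Proof. exact: ghom_src. Qed.
Lemma q_rng a : q (grng a) = grng (q a). Proof. exact: ghom_rng. Qed.
Lemma q_mul a b : gsrc a = grng b -> q (gmul a b) = gmul (q a) (q b).
Proof. by case/homq. Qed.

Lemma unit_q_inj (x y : Sigma) :
  gunits Sigma x -> gunits Sigma y -> q x = q y -> x = y.
Proof.
have [[_ + _] _ _] := twist_q_units tw.
by move=> qinj xu yu; apply: qinj; apply/mem_set.
Qed.

(** As q is injective on units, coincidences between sources and ranges in Sigma
    can be tested in G. *)
Lemma eq_rngP a b : (grng a = grng b) <-> (grng (q a) = grng (q b)).
Proof.
split=> [ab|ab]; first by rewrite -!q_rng ab.
by apply: unit_q_inj; [exact: gunits_rng|exact: gunits_rng|rewrite !q_rng].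
Qed.

Lemma eq_srcP a b : (gsrc a = gsrc b) <-> (gsrc (q a) = gsrc (q b)).
Proof.
split=> [ab|ab]; first by rewrite -!q_src ab.
by apply: unit_q_inj; [exact: gunits_src|exact: gunits_src|rewrite !q_src].
Qed.

Lemma eq_src_rngP a b : (gsrc a = grng b) <-> (gsrc (q a) = grng (q b)).
Proof.
split=> [ab|ab]; first by rewrite -q_src -q_rng ab.
by apply: unit_q_inj; [exact: gunits_src|exact: gunits_rng|rewrite q_src q_rng].
Qed.

Lemma q_i (x : gunits G) t : q (i (x, t)) = \val x.
Proof.
have : (q @^-1` [set \val x]) (i (x, t)).
  by rewrite -(twist_fibre tw); exists (x, t).
by [].
Qed.

Lemma grng_unitE (x y : G) : grng x = grng y -> grng_unit x = grng_unit y.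
Proof. by move=> xy; apply: val_inj. Qed.

Lemma src_act t a : gsrc (i (grng_unit (q a), t)) = grng a.
Proof.
apply/eq_src_rngP; rewrite q_i.
exact: (set_valP (grng_unit (q a))).
Qed.

Lemma q_act t a : q (twist_act i q t a) = q a.
Proof. by rewrite q_mul ?src_act// q_i gmul_rng. Qed.

Lemma act_mull t a b : gsrc a = grng b ->
  twist_act i q t (gmul a b) = gmul (twist_act i q t a) b.
Proof.
move=> ab; have E : grng_unit (q (gmul a b)) = grng_unit (q a).
  by apply: grng_unitE; rewrite q_mul// grngM//; apply/eq_src_rngP.
by rewrite /twist_act E gmulA// src_act.
Qed.

(** The arrow b a^-1 lies over a unit, hence comes from the group bundle. *)
Lemma q_fibre a b : q a = q b -> exists t, b = twist_act i q t a.
Proof.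
move=> ab; have baV : gsrc b = grng (ginv a).
  by rewrite grngV; apply/eq_srcP; rewrite ab.
have : (q @^-1` [set \val (grng_unit (q a))]) (gmul b (ginv a)).
  by rewrite /preimage /= q_mul// (ghomV homq) -ab gmulV.
rewrite -(twist_fibre tw) => -[[x t] /= -> e]; exists t.
rewrite /twist_act e -gmulA ?gsrcV// gmulVg.
have -> : gsrc a = gsrc b by apply/eq_srcP; rewrite ab.
by rewrite gmul_src.
Qed.

End Twists.

(** * Equivariant functions and their decomposition over bisections *)

Section Functions.
Variables (R : comPzRingType) (G Sigma : topologicalGroupoidType).
Variables (i : unit_bundle G R -> Sigma) (q : Sigma -> G).
Hypothesis hausG : hausdorff_space G.
Hypothesis ampleG : ample G.
Hypothesis tw : discrete_twist i q.
Implicit Types (a b : Sigma) (t : ring_units R) (f g h : Sigma -> R^o).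
Implicit Types (alpha beta : G) (B K : set G).

Local Notation A := (twisted_steinberg i q).
Local Notation supp := (supp_quot q).

(** The bisections used to cut functions: besides being clopen, they carry a
    continuous section of q. The conditions are put on the range map because the
    convolution sums over arrows with a prescribed range. *)
Definition slice (B : set G) (P : G -> Sigma) : Prop :=
  [/\ clopen B, range_inj B,
      (forall U : set G, open U -> open (@grng G @` (U `&` B))),
      {within B, continuous P} &
      (forall beta, B beta -> q (P beta) = beta)].

(** A compact open bisection inside a trivialising neighbourhood of alpha; it is
    closed because G is Hausdorff. *)
Lemma slice_ex alpha : exists B P, slice B P /\ B alpha.
Proof.
have [C [P [[oC _ _ _ _] Ca cP qP _]]] := twist_local_triv tw alpha.
have [_ /(_ alpha C (open_nbhs_nbhs (conj oC Ca)))] := ampleG.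
move=> [B [[cB [oB orB _ hrB _]] Ba] BC].
exists B, P; split=> //; split.
- by split=> //; exact: compact_closed.
- move=> x y Bx By; have [[_ rinj _] _ _] := hrB.
  by apply: rinj; exact/mem_set.
- by move=> U /(let: And3 _ _ h := hrB in h _) [V oV ->]; exact: openI.
- exact: continuous_subspaceW cP.
- by move=> x /BC; exact: qP.
Qed.

Lemma compact_slices K : compact K ->
  exists s : seq (set G), (forall B, B \in s -> exists P, slice B P) /\
    forall alpha, K alpha -> exists2 B, B \in s & B alpha.
Proof.
move=> cK.
have [_ [P [[]]]//|alpha|s [ss Kcov]] :=
  compact_seq_cover (Q := [set B | exists P, slice B P]) cK.
  by have [B [P [sB Ba]]] := slice_ex alpha; exists B => //; exists P.
by exists s; split=> [B /ss|alpha /Kcov[B]] //; exists B.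
Qed.

(** Finitely many slices cover K, and each has at most one arrow with range x.
    This is why the sums defining the convolution are finite. *)
Lemma finite_range_fibre K (x : G) : compact K ->
  finite_set [set alpha | K alpha /\ grng alpha = x].
Proof.
move=> /compact_slices [s [ss cov]].
apply: (@sub_finite_set _ _
  (\bigcup_(B in [set` s]) [set alpha | B alpha /\ grng alpha = x])).
  by move=> alpha [/cov[B Bs Ba] ax]; exists B.
apply: bigcup_finite => [|B /ss[P [_ rinj _ _ _]]]; first exact: finite_seq.
have [[beta [Bb bx]]|noB] := pselect (exists beta, B beta /\ grng beta = x).
  apply: (@sub_finite_set _ _ [set beta]) => [alpha [Ba ax]|].
    by apply: rinj => //; rewrite ax.
  exact: finite_set1.
by apply: (@sub_finite_set _ _ set0) => // alpha ?; case: noB; exists alpha.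
Qed.

Definition locally_constant f := forall a, \forall b \near a, f b = f a.
Definition equivariant f :=
  forall t a, f (twist_act i q t a) = uval t^-1%g * f a.

(** Equivariance makes the support of f a union of fibres of q. *)
Lemma supp_quotP f a : equivariant f -> supp f (q a) <-> f a != 0.
Proof.
move=> ef; split=> [[b fb ba]|]; last by exists a.
have [t bE] := q_fibre tw (esym ba).
by move: fb; rewrite /= bE ef; apply: contraNN => /eqP->; rewrite mulr0.
Qed.

Lemma slice_near B P alpha (W : set Sigma) : slice B P -> B alpha ->
  nbhs (P alpha) W -> \forall beta \near alpha, B beta /\ W (P beta).
Proof.
move=> [[oB _] _ _ /subspace_continuousP cP _] Ba WP.
have WB : \forall beta \near alpha, B beta -> W (P beta) := cP alpha Ba W WP.
by apply: filterS2 WB (open_nbhs_nbhs (conj oB Ba)) => beta; split=> //; auto.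
Qed.

(** Near alpha, membership in the support is tested on a continuous section of
    q, along which f is locally constant. *)
Lemma near_supp f alpha : locally_constant f -> equivariant f ->
  \forall beta \near alpha, supp f beta <-> supp f alpha.
Proof.
move=> lf ef; have [B [P [sB Ba]]] := slice_ex alpha.
apply: filterS (slice_near sB Ba (lf (P alpha))) => beta [Bb fP].
case: sB => _ _ _ _ qP.
rewrite -[in X in X <-> _](qP _ Bb) -[in X in _ <-> X](qP _ Ba).
by rewrite !supp_quotP// fP.
Qed.

Lemma supp_clopen f : locally_constant f -> equivariant f -> clopen (supp f).
Proof.
move=> lf ef; split.
  rewrite openE => alpha fa.
  by apply: filterS (near_supp alpha lf ef) => beta [_]; exact.
rewrite -openC openE => alpha fa.
by apply: filterS (near_supp alpha lf ef) => beta [h _] /h.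
Qed.

(** Since the support is clopen, its compactness amounts to being contained in
    some compact set. *)
Lemma steinberg_of_compact f K : locally_constant f -> equivariant f ->
  compact K -> supp f `<=` K -> A f.
Proof.
move=> lf ef cK sK; split=> //.
by apply: subclosed_compact cK sK; case: (supp_clopen lf ef).
Qed.

Lemma supp0 : supp (0 : Sigma -> R^o) = set0.
Proof. by apply/seteqP; split=> // alpha [a /= /eqP]. Qed.

Lemma suppD f g : supp (f + g) `<=` supp f `|` supp g.
Proof.
move=> _ [a fga <-]; have [fa|fa] := eqVneq (f a) 0; last by left; exists a.
by right; exists a => //; move: fga; rewrite /= addrfctE fa add0r.
Qed.

Lemma suppZ (c : R) f : supp (c *: f) `<=` supp f.
Proof.
move=> _ [a fa <-]; exists a => //; move: fa; apply: contraNN => /eqP fa.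
by rewrite /= scalrfctE fa scaler0.
Qed.

Lemma steinberg_submodule : submodule A.
Proof.
split.
- apply: (@steinberg_of_compact _ set0); [|by move=> t a; rewrite mulr0| |].
  + by move=> a; exact: nearW.
  + exact: compact0.
  + by rewrite supp0.
- move=> f g [lf ef cf] [lg eg cg].
  apply: (@steinberg_of_compact _ (supp f `|` supp g)).
  + move=> a; apply: filterS2 (lf a) (lg a) => b.
    by rewrite !addrfctE => -> ->.
  + by move=> t a; rewrite !addrfctE ef eg mulrDr.
  + exact: compactU.
  + exact: suppD.
- move=> c f [lf ef cf]; apply: (@steinberg_of_compact _ (supp f)) => //.
  + by move=> a; apply: filterS (lf a) => b; rewrite !scalrfctE => ->.
  + by move=> t a; rewrite !scalrfctE ef; exact: mulrCA.
  + exact: suppZ.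
Qed.

Definition restr B f : Sigma -> R^o := fun a => if q a \in B then f a else 0.

Lemma supp_restr B f : supp (restr B f) `<=` supp f `&` B.
Proof.
move=> _ [a + <-]; rewrite /= /restr; case: ifPn; last by rewrite eqxx.
by rewrite inE => Ba fa; split=> //; exists a.
Qed.

Lemma restrID B f : f = restr B f + restr (~` B) f.
Proof.
apply/funext => a; rewrite addrfctE /restr in_setC.
by case: (q a \in B); rewrite ?addr0 ?add0r.
Qed.

Lemma steinberg_restr B f : clopen B -> A f -> A (restr B f).
Proof.
move=> clB [lf ef cf]; apply: (@steinberg_of_compact _ (supp f)) => //.
- move=> a; have : \forall b \near a, (q b \in B) = (q a \in B).
    exact: (twist_q_continuous tw (clopen_near _ clB)).
  by apply: filterS2 (lf a) => b fb qb; rewrite /restr qb fb.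
- move=> t a; rewrite /restr (q_act tw) ef.
  by case: ifP => //; rewrite mulr0.
- by move=> alpha /supp_restr[].
Qed.

(** By induction on the number of bisections in a finite cover of supp_G f: if B
    is one of them, the restriction of f to the complement of the clopen set B
    is supported in the union of the others. *)
Lemma steinberg_ind (Q : (Sigma -> R^o) -> Prop) :
  Q 0 ->
  (forall f g, A f -> A g -> Q f -> Q g -> Q (f + g)) ->
  (forall f B P, A f -> slice B P -> supp f `<=` B -> Q f) ->
  forall f, A f -> Q f.
Proof.
move=> Q0 QD QB f Af; have [_ _ cf] := Af.
have [s [ss cov]] := compact_slices cf.
elim: s f Af ss cov {cf} => [|B s IH] f Af ss cov.
  suff -> : f = 0 by [].
  apply/funext => a; apply/eqP/negP => /negP fa.
  by have [] := cov (q a) (ex_intro2 _ _ a fa erefl).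
have [P sB] := ss B (mem_head _ _); have [clB _ _ _ _] := sB.
have clB' : clopen (~` B) by case: clB => ? ?; split; rewrite ?openC ?closedC.
have AB := steinberg_restr clB Af; have AB' := steinberg_restr clB' Af.
rewrite (restrID B f); apply: QD => //.
  by apply: (QB _ B P) => // alpha /supp_restr[].
apply: IH => // [C Cs|alpha /supp_restr[fa nBa]].
  by apply: ss; rewrite inE Cs orbT.
have [C] := cov alpha fa; rewrite inE => /predU1P[->//|Cs Ca].
by exists C.
Qed.

End Functions.

(** * The convolution algebra *)

Section Convolution.
Variables (R : comPzRingType) (G Sigma : topologicalGroupoidType).
Variables (i : unit_bundle G R -> Sigma) (q : Sigma -> G).
Hypothesis hausG : hausdorff_space G.
Hypothesis ampleG : ample G.
Hypothesis tw : discrete_twist i q.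
Implicit Types (a b : Sigma) (t : ring_units R) (f g h : Sigma -> R^o).
Implicit Types (alpha beta : G) (B K X : set G).

Local Notation A := (twisted_steinberg i q).
Local Notation supp := (supp_quot q).
Local Notation "f ** g" := (convolution q f g)
  (at level 40, left associativity).

(** The product computed with a section S defined on all of G, over any set X of
    arrows that contains those of supp_G f with the range of q a: this allows
    the products of different functions to be compared term by term. *)
Lemma convolutionE f g S X a : A f -> A g ->
  (forall alpha, q (S alpha) = alpha) ->
  (forall alpha, X alpha -> grng alpha = grng (q a)) ->
  (forall alpha, supp f alpha -> grng alpha = grng (q a) -> X alpha) ->
  (f ** g) a = \sum_(alpha \in X) f (S alpha) * g (gmul (ginv (S alpha)) a).
Proof.
move=> Af Ag qS Xr fX; have [_ ef _] := Af.
have fS : supp_section q f S.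
  by move=> alpha; rewrite -[in X in X -> _](qS alpha) (supp_quotP tw).
rewrite (convolution_section tw Af Ag fS).
apply: fsbig_widen => [alpha [fa ar]|alpha [/Xr ar nfa] /=]; first exact: fX.
have [->|fa] := eqVneq (f (S alpha)) 0; first by rewrite mul0r.
by case: nfa; split=> //; exists (S alpha).
Qed.

Lemma finite_supp_fibre f (x : G) : A f ->
  finite_set [set alpha | supp f alpha /\ grng alpha = x].
Proof. by move=> [_ _ cf]; exact: (finite_range_fibre hausG ampleG tw). Qed.

Lemma section_ex : exists S : G -> Sigma, forall alpha, q (S alpha) = alpha.
Proof. by have [S qS] := choice (twist_q_surj tw); exists S. Qed.

Lemma convolutionDl f g h : A f -> A g -> A h -> (f + g) ** h = f ** h + g ** h.
Proof.
move=> Af Ag Ah; apply/funext => a; rewrite -[RHS]/((f ** h) a + (g ** h) a).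
have [S qS] := section_ex.
have [_ AD _] := steinberg_submodule hausG ampleG tw.
pose X := [set alpha | (supp f `|` supp g) alpha /\ grng alpha = grng (q a)].
have finX : finite_set X.
  apply: (@sub_finite_set _ _
    ([set alpha | supp f alpha /\ grng alpha = grng (q a)] `|`
     [set alpha | supp g alpha /\ grng alpha = grng (q a)])).
    by move=> alpha [[fa|ga] ar]; [left|right].
  by rewrite finite_setU; split; exact: finite_supp_fibre.
have XE (k : Sigma -> R^o) : A k -> supp k `<=` supp f `|` supp g ->
    (k ** h) a = \sum_(alpha \in X) k (S alpha) * h (gmul (ginv (S alpha)) a).
  move=> Ak kfg; apply: convolutionE => // [alpha []//|alpha /kfg ? ?].
  by split.
rewrite !XE//; do ?[exact: AD|exact: suppD]; do ?by move=> alpha; [left|right].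
rewrite -fsbig_split//; apply: eq_fsbigr => alpha _.
by rewrite addrfctE mulrDl.
Qed.

Lemma convolutionDr f g h : A f -> A g -> A h -> f ** (g + h) = f ** g + f ** h.
Proof.
move=> Af Ag Ah; apply/funext => a; rewrite -[RHS]/((f ** g) a + (f ** h) a).
have [S qS] := section_ex.
have [_ AD _] := steinberg_submodule hausG ampleG tw.
have finX := finite_supp_fibre (grng (q a)) Af.
rewrite !(convolutionE (a := a) _ _ qS
            (fun _ => @proj2 _ _) (fun _ => @conj _ _))//; last exact: AD.
rewrite -fsbig_split//; apply: eq_fsbigr => alpha _.
by rewrite addrfctE mulrDr.
Qed.

Lemma convolutionZr (c : R) f g : A f -> A g -> f ** (c *: g) = c *: (f ** g).
Proof.
move=> Af Ag; apply/funext => a; rewrite -[RHS]/(c *: (f ** g) a).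
have [S qS] := section_ex.
have [_ _ AZ] := steinberg_submodule hausG ampleG tw.
have finX := finite_supp_fibre (grng (q a)) Af.
rewrite !(convolutionE (a := a) _ _ qS
            (fun _ => @proj2 _ _) (fun _ => @conj _ _))//; last exact: AZ.
rewrite !fsbig_finite// scaler_sumr; apply: eq_bigr => alpha _.
by rewrite scalrfctE; exact: mulrCA.
Qed.

Lemma convolutionZl (c : R) f g : A f -> A g -> (c *: f) ** g = c *: (f ** g).
Proof.
move=> Af Ag; apply/funext => a; rewrite -[RHS]/(c *: (f ** g) a).
have [S qS] := section_ex.
have [_ _ AZ] := steinberg_submodule hausG ampleG tw.
have finX := finite_supp_fibre (grng (q a)) Af.
pose X := [set alpha | supp f alpha /\ grng alpha = grng (q a)].
rewrite (@convolutionE f g S X)//; last by move=> alpha [].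
rewrite (@convolutionE (c *: f) g S X)//; first last.
- by move=> alpha /suppZ.
- by move=> alpha [].
- exact: AZ.
rewrite !fsbig_finite// scaler_sumr; apply: eq_bigr => alpha _.
by rewrite scalrfctE; symmetry; exact: mulrA.
Qed.

Lemma convolution_out f g a : A f -> A g ->
  (forall alpha, supp f alpha -> grng alpha <> grng (q a)) -> (f ** g) a = 0.
Proof.
move=> Af Ag fa; have [S qS] := section_ex.
by rewrite (@convolutionE _ _ S set0)// fsbig_set0.
Qed.

Lemma convolution0l g : A g -> 0 ** g = 0.
Proof.
move=> Ag; have [A0 _ _] := steinberg_submodule hausG ampleG tw.
by apply/funext => a; apply: convolution_out => // alpha; rewrite supp0.
Qed.

Lemma convolution0r f : f ** 0 = 0.
Proof. by apply/funext => a; apply: fsbig1 => alpha _; rewrite mulr0. Qed.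

(** The only arrow over which the sum can have a nonzero term is q a, and the
    section may be chosen to take the value a there. *)
Lemma convolution_bisection f g B a b : A f -> A g -> range_inj B ->
  supp f `<=` B -> B (q a) -> gsrc a = grng b ->
  (f ** g) (gmul a b) = f a * g b.
Proof.
move=> Af Ag injB fB Ba ab; have [S qS] := section_ex.
have rab : grng (q (gmul a b)) = grng (q a).
  by rewrite (q_mul tw)// grngM//; exact/(eq_src_rngP tw).
pose Sa alpha := if alpha == q a then a else S alpha.
rewrite (@convolutionE _ _ Sa [set q a])//.
- by rewrite fsbig_set1 /Sa eqxx gmulKV.
- by move=> alpha; rewrite /Sa; case: eqP => [->|].
- by move=> alpha ->; rewrite rab.
- by move=> alpha fa; rewrite rab; apply: injB => //; exact: fB.
Qed.

(** The factorisations to which convolution_bisection applies. *)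
Lemma factor_ex B a : (exists2 alpha, B alpha & grng alpha = grng (q a)) ->
  exists b c, [/\ B (q b), gsrc b = grng c & a = gmul b c].
Proof.
move=> [alpha Ba ar]; have [b qb] := twist_q_surj tw alpha.
have br : grng b = grng a by apply/(eq_rngP tw); rewrite qb.
exists b, (gmul (ginv b) a).
by split; [rewrite qb|rewrite grngM ?gsrcV// grngV|rewrite gmulVK].
Qed.

(** Some term f(b) g(b^-1 a) of the sum is nonzero, and then b and b^-1 a lie in
    the two supports. *)
Lemma supp_convolution f g : supp (f ** g) `<=` set_gmul (supp f) (supp g).
Proof.
move=> _ [a + <-]; rewrite /= /convolution /convolution_with.
apply: contra_neqP => nprod; apply: fsbig1 => alpha [fa ar].
apply: contra_notP nprod => /eqP.
have [] := some_sectionP a fa; set b := some_section _ _ _ _ => fb qb fg.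
have br : grng b = grng a by apply/(eq_rngP tw); rewrite qb.
have sV : gsrc (ginv b) = grng a by rewrite gsrcV.
have sb : gsrc b = grng (gmul (ginv b) a) by rewrite grngM// grngV.
exists (q b, q (gmul (ginv b) a)).
  split; last by rewrite /composable /=; apply/(eq_src_rngP tw).
  split; first by exists b.
  exists (gmul (ginv b) a) => //=.
  by apply: contraNneq fg => ->; rewrite mulr0.
by rewrite /= -(q_mul tw)// gmulVK.
Qed.

(** A point b near a factors as P beta . (P beta^-1 b) with beta near the arrow
    beta0 used at a; f is constant near P beta0, and g near P beta0^-1 a. If no
    arrow of supp_G f has the range of q a, then the same holds near a, as
    r(supp_G f) is closed. *)
Lemma convolution_locally_constant f g B P : A f -> A g -> slice q B P ->
  supp f `<=` B -> locally_constant (f ** g).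
Proof.
move=> Af Ag sB fB a; have [lf ef cf] := Af; have [lg _ _] := Ag.
have [_ injB openB _ qP] := sB.
have qrc : continuous (fun b => grng (q b)).
  move=> b; apply: continuous_comp; first exact: (twist_q_continuous tw).
  exact: grng_continuous.
have [[beta0 fb0 br0]|nfa] :=
  pselect (exists2 beta, supp f beta & grng beta = grng (q a)); last first.
  have crf : compact (@grng G @` supp f).
    apply: continuous_compact => //; apply: continuous_subspaceT.
    exact: grng_continuous.
  have orf : open (~` (@grng G @` supp f)).
    by rewrite openC; exact: compact_closed.
  have na : (~` (@grng G @` supp f)) (grng (q a)).
    by move=> [beta fb br]; apply: nfa; exists beta.
  have nb : \forall b \near a, ~ (@grng G @` supp f) (grng (q b)) :=
    qrc a _ (open_nbhs_nbhs (conj orf na)).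
  rewrite (convolution_out (a := a))//; last first.
    by move=> x fx xr; apply: na; exists x.
  apply: filterS nb => b nb; apply: convolution_out => // x fx xr.
  by apply: nb; exists x.
have Bb0 := fB _ fb0; set a0 := P beta0.
have a0r : grng a0 = grng a by apply/(eq_rngP tw); rewrite qP.
have sV : gsrc (ginv a0) = grng a by rewrite gsrcV.
have [[U W] /= [nU nW] UW] := near_gmul sV (lg (gmul (ginv a0) a)).
have nU' : \forall x \near a0, U (ginv x) := @ginv_continuous Sigma a0 _ nU.
have nf : \forall x \near a0, f x = f a0 /\ U (ginv x).
  by apply: filterS2 (lf a0) nU'.
have : nbhs beta0
    [set beta | B beta /\ (f (P beta) = f a0 /\ U (ginv (P beta)))].
  exact: slice_near sB Bb0 nf.
rewrite nbhsE => -[V [oV Vb0] VP].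
(* Points near a have the range of some beta in V, close to beta0. *)
have nV : \forall b \near a, (@grng G @` (V `&` B)) (grng (q b)).
  apply: (qrc a _ (open_nbhs_nbhs _)); split; first exact: openB.
  by exists beta0.
apply: filterS2 nW nV => b Wb [beta [/VP[Bb [fP UP]] _] br].
have key x y : B x -> grng x = grng (q y) ->
    (f ** g) y = f (P x) * g (gmul (ginv (P x)) y).
  move=> Bx xr; have Pr : grng (P x) = grng y by apply/(eq_rngP tw); rewrite qP.
  rewrite -{1}(gmulVK Pr); apply: (@convolution_bisection _ _ B) => //.
    by rewrite qP.
  by rewrite grngM ?gsrcV// grngV.
rewrite (key beta b)// (key beta0 a)// fP; congr (_ * _).
apply: (UW (ginv (P beta), b)) => //=.
by rewrite gsrcV; apply/(eq_rngP tw); rewrite qP.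
Qed.

Lemma convolution_equivariant f g B P : A f -> A g -> slice q B P ->
  supp f `<=` B -> equivariant i q (f ** g).
Proof.
move=> Af Ag [_ injB _ _ _] fB t a; have [_ ef _] := Af.
have [/factor_ex[b [c [Bb bc ->]]]|nB] :=
  pselect (exists2 alpha, B alpha & grng alpha = grng (q a)).
  rewrite (act_mull tw)// !(convolution_bisection Af Ag injB fB)//.
  - by rewrite ef mulrA.
  - by rewrite (q_act tw).
  - by rewrite -bc; apply/(eq_srcP tw); rewrite (q_act tw).
rewrite !convolution_out ?mulr0// => alpha /fB Ba; rewrite ?(q_act tw) => ar;
  by apply: nB; exists alpha.
Qed.

Lemma steinberg_convolution f g : A f -> A g -> A (f ** g).
Proof.
move=> Af Ag; move: f Af.
have [A0 AD _] := steinberg_submodule hausG ampleG tw.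
apply: (steinberg_ind hausG ampleG tw); first by rewrite convolution0l.
  by move=> f f' Af Af'; rewrite convolutionDl//; exact: AD.
move=> f B P Af sB fB.
apply: (steinberg_of_compact hausG ampleG tw (K := set_gmul (supp f) (supp g))).
- exact: convolution_locally_constant sB fB.
- exact: convolution_equivariant sB fB.
- by case: Af Ag => [? ? ?] [? ? ?]; exact: compact_set_gmul.
- exact: supp_convolution.
Qed.

(** Both sides are additive in f and in g, which may therefore be taken over
    bisections B and C; then f * g lives over the bisection BC. At a = bde with
    b over B and d over C, both sides are f(b) g(d) h(e); if a has no such
    factorisation, both vanish. *)
Lemma convolutionA f g h : A f -> A g -> A h -> f ** (g ** h) = f ** g ** h.
Proof.
move=> Af Ag Ah; move: f Af g Ag; have AM := steinberg_convolution.
apply: (steinberg_ind hausG ampleG tw).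
- by move=> g Ag; rewrite !convolution0l//; exact: AM.
- move=> f f' Af Af' IH IH' g Ag; rewrite !convolutionDl ?IH ?IH'//; exact: AM.
move=> f B P Af [_ injB _ _ _] fB.
apply: (steinberg_ind hausG ampleG tw).
- by rewrite convolution0l// !convolution0r convolution0l.
- move=> g g' Ag Ag' IH IH'.
  rewrite convolutionDl// !convolutionDr ?convolutionDl ?IH ?IH'//;
    exact: AM.
move=> g C Q Ag [_ injC _ _ _] gC; apply/funext => a.
have fgBC : supp (f ** g) `<=` set_gmul B C.
  move=> x /supp_convolution[[y z] [[/= fy gz] yz] <-].
  by exists (y, z) => //; split=> //; split; [exact: fB|exact: gC].
have injBC := range_inj_gmul injB injC.
have [/factor_ex[b [c [Bb bc ->]]]|nB] :=
  pselect (exists2 alpha, B alpha & grng alpha = grng (q a)); last first.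
  rewrite (convolution_out Af (AM _ _ Ag Ah)); last first.
    by move=> x /fB Bx xr; apply: nB; exists x.
  rewrite (convolution_out (AM _ _ Af Ag) Ah)// => x.
  move=> /fgBC[[y z] [[/= By Cz] yz] <-].
  by rewrite grngM// => yr; apply: nB; exists y.
rewrite (convolution_bisection Af _ injB)//; last exact: AM.
have [/factor_ex[d [e [Cd de cE]]]|nC] :=
  pselect (exists2 gamma, C gamma & grng gamma = grng (q c)).
  have bd : gsrc b = grng d by rewrite bc cE grngM.
  rewrite cE (convolution_bisection Ag _ injC)// gmulA//.
  rewrite (convolution_bisection (AM _ _ Af Ag) _ injBC)//.
  - by rewrite (convolution_bisection Af _ injB)// mulrA.
  - exists (q b, q d); last by rewrite (q_mul tw).
    by split=> //; apply/(eq_src_rngP tw).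
  - by rewrite gsrcM.
rewrite (convolution_out Ag Ah) ?mulr0; last first.
  by move=> x /gC Cx xr; apply: nC; exists x.
rewrite (convolution_out (AM _ _ Af Ag) Ah)// => x.
move=> /fgBC[[y z] [[/= By Cz] yz] <-].
have bc' : gsrc (q b) = grng (q c) by apply/(eq_src_rngP tw).
rewrite (q_mul tw)// !grngM// => yr; have yE := injB _ _ By Bb yr.
by apply: nC; exists z => //; rewrite -bc' -yE.
Qed.

Lemma steinberg_assoc_algebra : assoc_algebra A (convolution q).
Proof.
split.
- exact: steinberg_submodule.
- exact: steinberg_convolution.
- exact: convolutionA.
- exact: convolutionDl.
- exact: convolutionDr.
- exact: convolutionZl.
- exact: convolutionZr.
Qed.

End Convolution.

(** * The grading *)

Section Grading.
Variables (Gamma : groupType) (G : topologicalGroupoidType) (c : G -> Gamma).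
Hypothesis cc : group_cocycle c.

Lemma cocycle_near (x : G) : \forall y \near x, c y = c x.
Proof.
have [ccont _] := cc.
exact: (ccont x _ (@discrete_set1 (discrete_topology Gamma) (c x))).
Qed.

Lemma cocycle_clopen gamma : clopen (c @^-1` [set gamma]).
Proof.
split.
  rewrite openE => x /= <-; exact: cocycle_near.
rewrite -openC openE => x /= cx.
by apply: filterS (cocycle_near x) => y /= ->.
Qed.

(** The fibres of c form an open partition. *)
Lemma cocycle_finite (K : set G) : compact K -> finite_set (c @` K).
Proof.
move=> cK; pose Q := [set c @^-1` [set gamma] | gamma in [set: Gamma]].
have [||s [sQ Kcov]] := @compact_seq_cover _ K Q cK.
- by move=> _ [gamma _ <-]; case: (cocycle_clopen gamma).
- by move=> x; exists (c @^-1` [set c x]) => //; exists (c x).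
apply: (@sub_finite_set _ _ (\bigcup_(B in [set` s]) c @` B)).
  by move=> _ [x /Kcov[B Bs Bx] <-]; exists B => //; exists x.
apply: bigcup_finite => [|B /sQ[gamma _ <-]]; first exact: finite_seq.
apply: (@sub_finite_set _ _ [set gamma]); last exact: finite_set1.
by move=> _ [x /= <- <-].
Qed.

End Grading.

Theorem proposition4p2 (R : comPzRingType) (Gamma : groupType)
    (G Sigma : topologicalGroupoidType)
    (i : unit_bundle G R -> Sigma) (q : Sigma -> G)
    (cSigma : Sigma -> Gamma) (cG : G -> Gamma)
    (G_hausdorff : hausdorff_space G) (G_ample : ample G)
    (twist : discrete_twist i q) (grading : twist_grading q cSigma cG) :
  graded_algebra (twisted_steinberg i q) (convolution q)
    (steinberg_component i q cG).
Proof.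
have [_ cc _] := grading.
have [A0 AD AZ] := steinberg_submodule G_hausdorff G_ample twist.
split.
- exact: steinberg_assoc_algebra.
- move=> gamma; split.
  + by split=> // x; rewrite supp0.
  + move=> f g [Af fc] [Ag gc]; split; first exact: AD.
    by move=> x /suppD[/fc|/gc].
  + move=> r f [Af fc]; split; first exact: AZ.
    by move=> x /suppZ/fc.
- split=> [gamma f []//|u Au].
  pose w gamma := restr q (cG @^-1` [set gamma]) u.
  have wP gamma : steinberg_component i q cG gamma (w gamma).
    split; last by move=> x /supp_restr[].
    by apply: steinberg_restr => //; exact: cocycle_clopen.
  (* In any decomposition v, only one component can be nonzero at a. *)
  have w0 (v : Gamma -> Sigma -> R^o) a :
      (forall gamma, steinberg_component i q cG gamma (v gamma)) ->
      forall gamma, gamma != cG (q a) -> v gamma a = 0.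
    move=> vP gamma ga; apply/eqP; apply: contraNT ga => va.
    have [_ vc] := vP gamma.
    by apply/eqP; symmetry; apply: vc; exists a.
  have wfin : finite_set [set gamma | w gamma != 0].
    have [_ _ cu] := Au; apply: sub_finite_set (cocycle_finite cc cu).
    move=> gamma /=; apply: contra_neqP => nu; apply/funext => a.
    rewrite /w /restr; case: ifPn => //; rewrite inE /= => ca.
    apply/eqP; apply: contra_notT nu => ua.
    by exists (q a) => //; exists a.
  exists w; split; first split=> //.
  + apply/funext => a; rewrite (fsum_eval wfin (w0 w a wP)).
    by rewrite /w /restr ifT// inE.
  + move=> v [vP vfin uE]; apply/funext => gamma; apply/funext => a.
    rewrite /w /restr; have [ga|ga] := eqVneq gamma (cG (q a)).
      by rewrite ifT ?inE//= uE (fsum_eval vfin (w0 v a vP)) ga.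
    rewrite ifN ?w0//; apply/negP; rewrite inE /= => /esym/eqP.
    exact/negP.
- move=> gamma lambda f g [Af fc] [Ag gc].
  split; first exact: (steinberg_convolution G_hausdorff G_ample twist).
  move=> x /(supp_convolution twist)[[y z] [[/= fy gz] yz] <-] /=.
  by have [_ ->//] := cc; rewrite (fc _ fy) (gc _ gz).
Qed.
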